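(* Let $m,n\ge0$ be integers. On $\mathbb H\setminus\mathbb R$, $$H^Q_{m,n}(q,\overline q)=e^{-\overline{\partial}_s\partial_s}\left(q^m\overline q^{\,n}\right):=\sum_{k=0}^{\infty}\frac{(-1)^k}{k!}\left(\partial_s\overline\partial_s\right)^k\left(q^m\overline q^{\,n}\right).$$
   Context: $\mathbb H$ is the algebra of real quaternions, $\mathbb S=\{I\in\mathbb H: I^2=-1\}$, $\overline q$ is the quaternionic conjugate. Every $q\in\mathbb H\setminus\mathbb R$ is written uniquely as $q=x+yI_q$ with $x\in\mathbb R$, $y>0$, $I_q\in\mathbb S$. For a real differentiable $f$, the left slice derivatives at $q\in\mathbb H\setminus\mathbb R$ are $$\partial_s f(q)=\tfrac12\left(\frac{\partial f_{I_q}}{\partial x}-I_q\frac{\partial f_{I_q}}{\partial y}\right)(q),\qquad \overline{\partial}_s f(q)=\tfrac12\left(\frac{\partial f_{I_q}}{\partial x}+I_q\frac{\partial f_{I_q}}{\partial y}\right)(q),$$ where $f_I$ is the restriction of $f$ to the slice $L_I=\mathbb R+\mathbb R I$, with coordinates $(x,y)\mapsto x+yI$. For integers $m,n\ge0$, $$H^Q_{m,n}(q,\overline q)=\sum_{k=0}^{\min(m,n)}(-1)^k k!\binom mk\binom nk q^{m-k}\overline q^{\,n-k}.$$ *)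

(* Defs.v *)
From HB Require Import structures.
From mathcomp Require Import all_boot all_order all_algebra.
From mathcomp Require Import all_classical all_reals all_analysis.
From mathcomp Require Import ring lra.

Set Implicit Arguments.
Unset Strict Implicit.
Unset Printing Implicit Defensive.

Import Order.TTheory GRing.Theory Num.Theory.
Import numFieldNormedType.Exports.

Local Open Scope classical_set_scope.
Local Open Scope ring_scope.

(* [Quaternion a b c d] stands for a + b i + c j + d k. *)
Record quaternion (R : Type) := Quaternion { qa : R; qb : R; qc : R; qd : R }.

Lemma quaternion_eqP (R : Type) (p q : quaternion R) :
  qa p = qa q -> qb p = qb q -> qc p = qc q -> qd p = qd q -> p = q.
Proof. by case: p q => [a b c d] [a' b' c' d'] /= -> -> -> ->. Qed.

Section QuaternionChoice.
Variable R : Type.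
Definition quaternion_to_tuple (q : quaternion R) := (qa q, qb q, qc q, qd q).
Definition quaternion_of_tuple (t : R * R * R * R) :=
  let: (a, b, c, d) := t in Quaternion a b c d.
Lemma quaternion_to_tupleK : cancel quaternion_to_tuple quaternion_of_tuple.
Proof. by case. Qed.
End QuaternionChoice.

HB.instance Definition _ (R : choiceType) := Choice.copy (quaternion R)
  (can_type (@quaternion_to_tupleK R)).

Section QuaternionAlgebra.
Variable R : realType.
Implicit Types p q r : quaternion R.

Definition addq p q :=
  Quaternion (qa p + qa q) (qb p + qb q) (qc p + qc q) (qd p + qd q).
Definition oppq p := Quaternion (- qa p) (- qb p) (- qc p) (- qd p).

Fact addqA : associative addq.
Proof. by move=> p q r; apply: quaternion_eqP => /=; ring. Qed.
Fact addqC : commutative addq.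
Proof. by move=> p q; apply: quaternion_eqP => /=; ring. Qed.
Fact add0q : left_id (Quaternion 0 0 0 0) addq.
Proof. by move=> p; apply: quaternion_eqP => /=; ring. Qed.
Fact addNq : left_inverse (Quaternion 0 0 0 0) oppq addq.
Proof. by move=> p; apply: quaternion_eqP => /=; ring. Qed.
HB.instance Definition _ :=
  GRing.isZmodule.Build (quaternion R) addqA addqC add0q addNq.

(* i^2 = j^2 = k^2 = ijk = -1 *)
Definition mulq p q := Quaternion
  (qa p * qa q - qb p * qb q - qc p * qc q - qd p * qd q)
  (qa p * qb q + qb p * qa q + qc p * qd q - qd p * qc q)
  (qa p * qc q - qb p * qd q + qc p * qa q + qd p * qb q)
  (qa p * qd q + qb p * qc q - qc p * qb q + qd p * qa q).

Fact mulqA : associative mulq.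
Proof. by move=> p q r; apply: quaternion_eqP => /=; ring. Qed.
Fact mul1q : left_id (Quaternion 1 0 0 0) mulq.
Proof. by move=> p; apply: quaternion_eqP => /=; ring. Qed.
Fact mulq1 : right_id (Quaternion 1 0 0 0) mulq.
Proof. by move=> p; apply: quaternion_eqP => /=; ring. Qed.
Fact mulqDl : left_distributive mulq +%R.
Proof. by move=> p q r; apply: quaternion_eqP => /=; ring. Qed.
Fact mulqDr : right_distributive mulq +%R.
Proof. by move=> p q r; apply: quaternion_eqP => /=; ring. Qed.
Fact oneq_neq0 : Quaternion 1 0 0 0 != 0 :> quaternion R.
Proof. by apply/eqP => -[] /eqP; rewrite oner_eq0. Qed.
HB.instance Definition _ := GRing.Zmodule_isNzRing.Build (quaternion R)
  mulqA mul1q mulq1 mulqDl mulqDr oneq_neq0.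

Definition scaleq (a : R) p :=
  Quaternion (a * qa p) (a * qb p) (a * qc p) (a * qd p).

Fact scaleqA a b p : scaleq a (scaleq b p) = scaleq (a * b) p.
Proof. by apply: quaternion_eqP => /=; ring. Qed.
Fact scale1q : left_id 1 scaleq.
Proof. by move=> p; apply: quaternion_eqP => /=; ring. Qed.
Fact scaleqDr : right_distributive scaleq +%R.
Proof. by move=> a p q; apply: quaternion_eqP => /=; ring. Qed.
Fact scaleqDl p : {morph scaleq^~ p : a b / a + b}.
Proof. by move=> a b; apply: quaternion_eqP => /=; ring. Qed.
HB.instance Definition _ := GRing.Zmodule_isLmodule.Build R (quaternion R)
  scaleqA scale1q scaleqDr scaleqDl.

Fact scaleqAl (a : R) p q : a *: (p * q) = (a *: p) * q.
Proof. by apply: quaternion_eqP => /=; ring. Qed.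
HB.instance Definition _ :=
  GRing.Lmodule_isLalgebra.Build R (quaternion R) scaleqAl.
Fact scaleqAr (a : R) p q : a *: (p * q) = p * (a *: q).
Proof. by apply: quaternion_eqP => /=; ring. Qed.
HB.instance Definition _ :=
  GRing.Lalgebra_isAlgebra.Build R (quaternion R) scaleqAr.

Definition normq p : R :=
  Num.sqrt (qa p ^+ 2 + qb p ^+ 2 + qc p ^+ 2 + qd p ^+ 2).

Lemma normq_ge0 p : 0 <= normq p. Proof. exact: sqrtr_ge0. Qed.

Lemma sqr_normq p :
  normq p ^+ 2 = qa p ^+ 2 + qb p ^+ 2 + qc p ^+ 2 + qd p ^+ 2.
Proof. by rewrite sqr_sqrtr// !addr_ge0// sqr_ge0. Qed.

Lemma dotq_le p q :
  qa p * qa q + qb p * qb q + qc p * qc q + qd p * qd q <= normq p * normq q.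
Proof.
have [|/ltW s0] := lerP 0
    (qa p * qa q + qb p * qb q + qc p * qc q + qd p * qd q); last first.
  by rewrite (le_trans s0)// mulr_ge0// normq_ge0.
move=> s0; rewrite -(@ler_pXn2r _ 2)// ?nnegrE ?mulr_ge0 ?normq_ge0//.
rewrite exprMn !sqr_normq -subr_ge0.
set a := qa p; set b := qb p; set c := qc p; set d := qd p.
set a' := qa q; set b' := qb q; set c' := qc q; set d' := qd q.
have -> : (a ^+ 2 + b ^+ 2 + c ^+ 2 + d ^+ 2) *
    (a' ^+ 2 + b' ^+ 2 + c' ^+ 2 + d' ^+ 2) -
    (a * a' + b * b' + c * c' + d * d') ^+ 2 =
  (a * b' - b * a') ^+ 2 + (a * c' - c * a') ^+ 2 + (a * d' - d * a') ^+ 2 +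
  (b * c' - c * b') ^+ 2 + (b * d' - d * b') ^+ 2 + (c * d' - d * c') ^+ 2.
  by ring.
by rewrite !addr_ge0// sqr_ge0.
Qed.

Fact ler_normqD p q : normq (p + q) <= normq p + normq q.
Proof.
rewrite -(@ler_pXn2r _ 2)// ?nnegrE ?addr_ge0 ?normq_ge0//.
rewrite sqrrD !sqr_normq/=.
have := dotq_le p q; lra.
Qed.

Fact normqZ (l : R) p : normq (l *: p) = `|l| * normq p.
Proof.
rewrite /normq/= -sqrtr_sqr -sqrtrM ?sqr_ge0//; congr Num.sqrt; ring.
Qed.

Fact normq0_eq0 p : normq p = 0 -> p = 0.
Proof.
move=> p0; have /eqP := sqr_normq p; rewrite p0 expr0n/= eq_sym.
rewrite !paddr_eq0 ?addr_ge0 ?sqr_ge0// !sqrf_eq0.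
by move=> /andP[/andP[/andP[/eqP ? /eqP ?] /eqP ?] /eqP ?]; exact: quaternion_eqP.
Qed.

HB.instance Definition _ :=
  Lmodule_isNormed.Build R (quaternion R) ler_normqD normqZ normq0_eq0.

Definition conjq p : quaternion R := Quaternion (qa p) (- qb p) (- qc p) (- qd p).

Definition imq p : quaternion R := Quaternion 0 (qb p) (qc p) (qd p).

Definition real_quaternion : set (quaternion R) := range (fun x : R => x%:A).

Definition imag_unit : set (quaternion R) := [set I | I * I = - 1].

(* The coordinates of q = x + y I_q for non-real q.  On real quaternions
   [slice_unit] is the junk value 0, which is never used below. *)
Definition slice_x q : R := qa q.
Definition slice_y q : R := `|imq q|.
Definition slice_unit q : quaternion R := (slice_y q)^-1 *: imq q.

Lemma sqr_slice_y q : slice_y q ^+ 2 = qb q ^+ 2 + qc q ^+ 2 + qd q ^+ 2.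
Proof. by rewrite [LHS]sqr_normq/= expr0n/= add0r. Qed.

Lemma slice_y_gt0 q : ~ real_quaternion q -> 0 < slice_y q.
Proof.
move=> qR; rewrite /slice_y normr_gt0; apply: contra_notN qR => /eqP[b c d].
by exists (qa q) => //; apply: quaternion_eqP => /=; rewrite ?b ?c ?d; ring.
Qed.

Lemma slice_unitP q : ~ real_quaternion q -> imag_unit (slice_unit q).
Proof.
move=> /slice_y_gt0 y0; have := sqr_slice_y q.
rewrite /slice_unit /imag_unit/=; move: (slice_y q) y0 => y y0 yE.
rewrite -scalerAl -scalerAr scalerA.
have y_neq0 : y != 0 by rewrite gt_eqF.
apply: quaternion_eqP => /=; last 3 first.
- by ring.
- by ring.
- by ring.
have -> : 0 * 0 - qb q * qb q - qc q * qc q - qd q * qd q = - y ^+ 2.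
  by rewrite yE; ring.
by field.
Qed.

Lemma sliceE q : ~ real_quaternion q ->
  q = (slice_x q)%:A + slice_y q *: slice_unit q.
Proof.
move=> /slice_y_gt0 y0; rewrite /slice_unit scalerA divff ?gt_eqF// scale1r.
by apply: quaternion_eqP => /=; rewrite /slice_x; ring.
Qed.

Lemma slice_unique (q I : quaternion R) (x y : R) :
  ~ real_quaternion q -> imag_unit I -> 0 < y -> q = x%:A + y *: I ->
  [/\ x = slice_x q, y = slice_y q & I = slice_unit q].
Proof.
move=> qR; rewrite /imag_unit/=; case: I => [a b c d] I1 y0 qE.
have ea : a * a - b * b - c * c - d * d = - 1 := congr1 (@qa R) I1.
have eb : a * b + b * a + c * d - d * c = - 0 := congr1 (@qb R) I1.
have ec : a * c - b * d + c * a + d * b = - 0 := congr1 (@qc R) I1.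
have ed : a * d + b * c - c * b + d * a = - 0 := congr1 (@qd R) I1.
have a0 : a = 0.
  apply/eqP/negPn/negP => an0.
  have z (t : R) : a * t = 0 -> t = 0.
    by move=> /eqP; rewrite mulf_eq0 (negbTE an0) => /eqP.
  have [b0 c0 d0] : [/\ b = 0, c = 0 & d = 0].
    by split; apply: z; lra.
  move: ea; rewrite b0 c0 d0 => ea; have := sqr_ge0 a; rewrite expr2; lra.
have qa_ : qa q = x * 1 + y * a by rewrite qE.
have qb_ : qb q = x * 0 + y * b by rewrite qE.
have qc_ : qc q = x * 0 + y * c by rewrite qE.
have qd_ : qd q = x * 0 + y * d by rewrite qE.
have yE : y = slice_y q.
  apply/eqP; rewrite -(@eqrXn2 _ 2)// ?(ltW y0) ?normr_ge0//.
  rewrite sqr_slice_y qb_ qc_ qd_; apply/eqP.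
  have -> : y ^+ 2 = y ^+ 2 * - (a * a - b * b - c * c - d * d) by rewrite ea; ring.
  by rewrite a0; ring.
split => //; first by rewrite /slice_x qa_ a0; ring.
have y_neq0 : y != 0 by rewrite gt_eqF.
by rewrite /slice_unit -yE; apply: quaternion_eqP => /=;
  rewrite ?qb_ ?qc_ ?qd_ ?a0; field.
Qed.

Definition slice_restr (f : quaternion R -> quaternion R) (I : quaternion R)
  (x y : R) : quaternion R := f (x%:A + y *: I).

Definition slice_dx (f : quaternion R -> quaternion R) (q : quaternion R) :=
  derive1 (fun x : R => slice_restr f (slice_unit q) x (slice_y q)) (slice_x q).

Definition slice_dy (f : quaternion R -> quaternion R) (q : quaternion R) :=
  derive1 (fun y : R => slice_restr f (slice_unit q) (slice_x q) y) (slice_y q).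

Definition slice_d (f : quaternion R -> quaternion R) (q : quaternion R) :
    quaternion R :=
  2^-1 *: (slice_dx f q - slice_unit q * slice_dy f q).

Definition slice_dbar (f : quaternion R -> quaternion R) (q : quaternion R) :
    quaternion R :=
  2^-1 *: (slice_dx f q + slice_unit q * slice_dy f q).

Definition quat_hermite (m n : nat) (q : quaternion R) : quaternion R :=
  \sum_(k < (minn m n).+1)
    ((-1) ^+ k * (k`! * 'C(m, k) * 'C(n, k))%:R) *:
      (q ^+ (m - k) * conjq q ^+ (n - k)).

End QuaternionAlgebra.

(* Main.v *)
Require Import Defs.
From HB Require Import structures.
From mathcomp Require Import all_boot all_order all_algebra.
From mathcomp Require Import all_classical all_reals all_analysis.
From mathcomp Require Import ring.

Import Order.TTheory GRing.Theory Num.Theory.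
Import numFieldNormedType.Exports.

Local Open Scope classical_set_scope.
Local Open Scope ring_scope.

(** On a slice [L_I] the quaternions are a copy of the complex plane: every
    [x + y I] commutes with [I], with its conjugate [x - y I], and with every
    other point of the slice.  The slice derivatives at a non-real [q] only
    differentiate along [L_I] with [I = I_q], so on [p^m (conj p)^n] they act
    as the Wirtinger operators do on [z^m (conj z)^n]: [slice_d] lowers the
    exponent of [p] and produces the factor [m], [slice_dbar] lowers the
    exponent of [conj p] and produces the factor [n]
    ([slice_d_qmonomial], [slice_dbar_qmonomial]).  Iterating the composite
    [k] times multiplies [p^(m-k) (conj p)^(n-k)] by the two falling factorials
    [m ^_ k] and [n ^_ k] ([iter_slice_d_slice_dbar]).  Since [m ^_ k] is
    [k! 'C(m, k)], dividing by [k!] leaves exactly the [k]-th coefficient of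
    the Hermite polynomial, and for [k > min(m, n)] one of the falling
    factorials vanishes: the exponential series is a finite sum, so its
    partial sums are eventually constant.

    The analytic input is the product rule for quaternion-valued functions of
    a real variable ([is_derive_mulq]), which rests on the multiplicativity of
    the norm.  Commutation inside a slice then turns it into the usual rule
    for powers ([is_deriveX_comm]) and for the product of powers
    ([is_derive_line_monomial]). *)

(** Euler's four-square identity. *)
Lemma normqM {R : realType} (p q : quaternion R) : `|p * q| = `|p| * `|q|.
Proof.
rewrite -[LHS]/(Defs.normq (p * q)) -[RHS]/(Defs.normq p * Defs.normq q).
rewrite /Defs.normq -sqrtrM; first by congr Num.sqrt => /=; ring.
by rewrite !addr_ge0// sqr_ge0.
Qed.

(** As for complex numbers, [f g - a b = (f - a) g + a (g - b)] and the norm is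
    multiplicative. *)
Lemma cvg_mulq {R : realType} (T : Type) (F : set_system T) {FF : Filter F}
    (f g : T -> quaternion R) (a b : quaternion R) :
  f @ F --> a -> g @ F --> b -> f x * g x @[x --> F] --> a * b.
Proof.
move=> fa gb.
suff dist0 : `|f x * g x - a * b| @[x --> F] --> (0 : R).
  by rewrite -subr_cvg0; exact: norm_cvg0 dist0.
have bound : (`|f x - a| * `|g x| + `|a| * `|g x - b|) @[x --> F]
    --> 0 * `|b| + `|a| * 0.
  have norm0 (h : T -> quaternion R) c : h @ F --> c ->
      `|h x - c| @[x --> F] --> (0 : R).
    by move=> /subr_cvg0 /cvg_norm; rewrite normr0.
  apply: cvgD; apply: cvgM; [exact: norm0|exact: cvg_norm|exact: cvg_cst|].
  exact: norm0.
rewrite mul0r mulr0 addr0 in bound.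
suff : \forall x \near F, 0 <= `|f x * g x - a * b|
    <= `|f x - a| * `|g x| + `|a| * `|g x - b|.
  by move=> /squeeze_cvgr; apply => //; exact: cvg_cst.
near=> x; rewrite normr_ge0/= -!normqM.
have -> : f x * g x - a * b = (f x - a) * g x + a * (g x - b).
  by rewrite mulrBl mulrBr addrA subrK.
exact: ler_normD.
Unshelve. all: by end_near. Qed.

(** The usual product rule; the order of the factors matters because [df] need
    not commute with [g t]. *)
Lemma is_derive_mulq {R : realType} (f g : R -> quaternion R) (t : R)
    (df dg : quaternion R) :
  is_derive t 1 f df -> is_derive t 1 g dg ->
  is_derive t 1 (fun s => f s * g s) (df * g t + f t * dg).
Proof.
move=> [fD fE] [gD gE].
have lim : (fun h => h^-1 *: (((fun s => f s * g s) \o shift t) (h *: 1) -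
    f t * g t)) @ 0^' --> df * g t + f t * dg.
  rewrite [X in X @ _](_ : _ = fun h : R =>
      (h^-1 *: ((f \o shift t) (h *: 1) - f t)) * g t +
      (f \o shift t) h * (h^-1 *: ((g \o shift t) (h *: 1) - g t))); last first.
    apply/funext => h /=; rewrite -scalerAl -scalerAr -scalerDr.
    by rewrite [h%:A]mulr1 mulrBl mulrBr [in RHS]addrC addrA subrK.
  rewrite -fE -gE; apply: cvgD.
    by apply: cvg_mulq; [exact: fD|exact: cvg_cst].
  apply: cvg_mulq; last exact: gD.
  apply/continuous_withinNshiftx/differentiable_continuous.
  exact/derivable1_diffP.
by split; [apply/cvg_ex; eexists; exact: lim|exact: cvg_lim lim].
Qed.

(** Without the commutation hypothesis the derivative of the power would be a
    sum of [n] different words in [f t] and [df].  For [n = 0] the factor [n%:R]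
    absorbs the truncated exponent [n.-1]. *)
Lemma is_deriveX_comm {R : realType} (f : R -> quaternion R) (t : R)
    (df : quaternion R) (n : nat) :
  is_derive t 1 f df -> GRing.comm (f t) df ->
  is_derive t 1 (fun s => f s ^+ n) (n%:R *: (df * f t ^+ n.-1)).
Proof.
move=> fD fC; elim: n => [|n IHn].
  by rewrite scale0r; exact: is_derive_cst.
rewrite (_ : (fun s => _) = fun s => f s * f s ^+ n); last first.
  by apply/funext => s; rewrite exprS.
apply: is_derive_eq; first exact: is_derive_mulq fD IHn.
rewrite -scalerAr mulrA fC -mulrA -exprS.
case: n {IHn} => [|n] /=; first by rewrite scale0r addr0 scale1r.
by rewrite -[X in X + _]scale1r -scalerDl nat1r.
Qed.

Definition qmonomial {R : realType} (m n : nat) (p : quaternion R) :=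
  p ^+ m * conjq p ^+ n.

(** The slice through [q] meets the reals only where [y = 0].  Hence the values
    that enter the slice derivatives at [q] are, near [q], values at non-real
    points. *)
Lemma slice_point_nonreal {R : realType} (q : quaternion R) (x y : R) :
  ~ real_quaternion q -> 0 < y ->
  ~ real_quaternion (x%:A + y *: slice_unit q).
Proof.
move=> qR y0 [r _ rE]; have /slice_unitP := qR.
have -> : slice_unit q = y^-1 *: (r - x)%:A.
  by rewrite scalerBl rE addrC addKr scalerA mulVf ?gt_eqF// scale1r.
rewrite /imag_unit/= scalerA => /(congr1 (@qa R)) /= /eqP.
rewrite !mulr0 !subr0 mulr1 -expr2 => /eqP sq.
by have := sqr_ge0 (y^-1 * (r - x)); rewrite sq oppr_ge0 ler10.
Qed.

Lemma conjq_slice {R : realType} (q : quaternion R) (x y : R) :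
  conjq (x%:A + y *: slice_unit q) = x%:A - y *: slice_unit q.
Proof. by apply: quaternion_eqP => /=; ring. Qed.

Lemma is_derive_line {R : realType} (a v : quaternion R) (t : R) :
  is_derive t 1 (fun s : R => a + s *: v) v.
Proof.
have lim : (fun h => h^-1 *: (((fun s : R => a + s *: v) \o shift t) (h *: 1) -
    (a + t *: v))) @ 0^' --> v.
  apply: cvg_near_cst; near=> h; rewrite /= [h%:A]mulr1.
  rewrite opprD addrACA subrr add0r scalerDl addrK scalerA mulVf ?scale1r//.
  by near: h; exact: nbhs_dnbhs_neq.
by split; [apply/cvg_ex; exists v|exact: cvg_lim lim].
Unshelve. all: by end_near. Qed.

Lemma comm_slice {R : realType} (q : quaternion R) (x y x' y' : R) :
  GRing.comm (x%:A + y *: slice_unit q) (x'%:A + y' *: slice_unit q).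
Proof. by apply: quaternion_eqP => /=; ring. Qed.

(** Both slice directions are instances: a point of the slice and its conjugate
    move along lines with velocities [1] and [1] when [x] varies, and with
    velocities [I] and [- I] when [y] varies. *)
Lemma is_derive_line_monomial {R : realType} (m n : nat) (z zc v vc : quaternion R)
    (t : R) (w := z + t *: v) (wc := zc + t *: vc) :
  GRing.comm w v -> GRing.comm wc vc -> GRing.comm w vc ->
  is_derive t 1 (fun s : R => (z + s *: v) ^+ m * (zc + s *: vc) ^+ n)
    (v * (m%:R *: (w ^+ m.-1 * wc ^+ n)) + vc * (n%:R *: (w ^+ m * wc ^+ n.-1))).
Proof.
move=> wv wvc wcom.
have dw := @is_deriveX_comm _ _ t v m (is_derive_line z v t) wv.
have dwc := @is_deriveX_comm _ _ t vc n (is_derive_line zc vc t) wvc.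
apply: is_derive_eq; first exact: is_derive_mulq dw dwc.
rewrite -/w -/wc -!scalerAl -!scalerAr -mulrA; congr (_ + _ *: _).
by rewrite mulrA -(commrX m (commr_sym wcom)) mulrA.
Qed.

(** Here, and in the lemmas below, [g] is only assumed to be a monomial off the
    reals: applied to a monomial, the slice operators have uncontrolled values
    at real points, so this is the form of hypothesis that can be iterated. *)
Lemma slice_dx_qmonomial {R : realType} (g : quaternion R -> quaternion R) (c : R)
    (m n : nat) (q : quaternion R) :
  (forall p, ~ real_quaternion p -> g p = c *: qmonomial m n p) ->
  ~ real_quaternion q ->
  slice_dx g q =
    c *: (m%:R *: qmonomial m.-1 n q + n%:R *: qmonomial m n.-1 q).
Proof.
move=> gE qR; set I := slice_unit q; set x := slice_x q; set y := slice_y q.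
have y0 : 0 < y by exact: slice_y_gt0.
have qE : q = y *: I + x *: 1 by rewrite addrC; exact: sliceE.
have qcE : conjq q = - (y *: I) + x *: 1.
  by rewrite {1}(sliceE qR) conjq_slice addrC.
rewrite /slice_dx derive1E -/I -/x -/y.
rewrite (@near_eq_derive _ _ _ _ (c \*: (fun s : R =>
    (y *: I + s *: 1) ^+ m * (- (y *: I) + s *: 1) ^+ n))); last first.
  near=> s; rewrite /slice_restr gE; last exact: slice_point_nonreal.
  by rewrite /= /qmonomial conjq_slice addrC [- _ + _]addrC.
have D : is_derive x 1 (fun s : R =>
    (y *: I + s *: 1) ^+ m * (- (y *: I) + s *: 1) ^+ n)
    (1 * (m%:R *: qmonomial m.-1 n q) + 1 * (n%:R *: qmonomial m n.-1 q)).
  rewrite /qmonomial {1 3}qE {1 2}qcE.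
  apply: is_derive_line_monomial; [exact: commr1|exact: commr1|exact: commr1].
by rewrite derive_val !mul1r.
Unshelve. all: by end_near. Qed.

Lemma slice_dy_qmonomial {R : realType} (g : quaternion R -> quaternion R) (c : R)
    (m n : nat) (q : quaternion R) :
  (forall p, ~ real_quaternion p -> g p = c *: qmonomial m n p) ->
  ~ real_quaternion q ->
  slice_dy g q = slice_unit q *
    (c *: (m%:R *: qmonomial m.-1 n q - n%:R *: qmonomial m n.-1 q)).
Proof.
move=> gE qR; set I := slice_unit q; set x := slice_x q; set y := slice_y q.
have y0 : 0 < y by exact: slice_y_gt0.
have qE : q = x%:A + y *: I by exact: sliceE.
have qcE : conjq q = x%:A + y *: - I.
  by rewrite {1}(sliceE qR) conjq_slice scalerN.
rewrite /slice_dy derive1E -/I -/x -/y.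
rewrite (@near_eq_derive _ _ _ _ (c \*: (fun s : R =>
    (x%:A + s *: I) ^+ m * (x%:A + s *: - I) ^+ n))); last first.
  near=> s; rewrite /slice_restr gE; last first.
    by apply: slice_point_nonreal => //; near: s; exact: lt_nbhsr.
  by rewrite /= /qmonomial conjq_slice scalerN.
have D : is_derive y 1 (fun s : R =>
    (x%:A + s *: I) ^+ m * (x%:A + s *: - I) ^+ n)
    (I * (m%:R *: qmonomial m.-1 n q) + - I * (n%:R *: qmonomial m n.-1 q)).
  have cI (s t : R) : GRing.comm (x%:A + s *: I) I.
    by have := @comm_slice R q x s 0 1; rewrite scale0r add0r scale1r.
  rewrite /qmonomial {1 3}qE {1 2}qcE; apply: is_derive_line_monomial.
  - exact: cI.
  - by rewrite scalerN -scaleNr; apply: commrN; exact: cI.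
  - by apply: commrN; exact: cI.
by rewrite derive_val mulNr -mulrBr scalerAr.
Unshelve. all: by end_near. Qed.

(** In [slice_dx - I slice_dy] the relation [I * I = -1] makes the terms in
    [n] cancel and doubles those in [m]; [slice_dbar] exchanges the two roles. *)
Lemma slice_d_qmonomial {R : realType} (g : quaternion R -> quaternion R) (c : R)
    (m n : nat) (q : quaternion R) :
  (forall p, ~ real_quaternion p -> g p = c *: qmonomial m n p) ->
  ~ real_quaternion q ->
  slice_d g q = (c * m%:R) *: qmonomial m.-1 n q.
Proof.
move=> gE qR; rewrite /slice_d (slice_dx_qmonomial _ _ _ _ _ gE qR).
rewrite (slice_dy_qmonomial _ _ _ _ _ gE qR) mulrA (slice_unitP qR) mulN1r opprK.
rewrite -scalerDr addrACA subrr addr0 -scalerDl !scalerA.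
by congr (_ *: _); field.
Qed.

Lemma slice_dbar_qmonomial {R : realType} (g : quaternion R -> quaternion R) (c : R)
    (m n : nat) (q : quaternion R) :
  (forall p, ~ real_quaternion p -> g p = c *: qmonomial m n p) ->
  ~ real_quaternion q ->
  slice_dbar g q = (c * n%:R) *: qmonomial m n.-1 q.
Proof.
move=> gE qR; rewrite /slice_dbar (slice_dx_qmonomial _ _ _ _ _ gE qR).
rewrite (slice_dy_qmonomial _ _ _ _ _ gE qR) mulrA (slice_unitP qR) mulN1r.
rewrite -scalerBr opprD opprK addrACA subrr add0r -scalerDl !scalerA.
by congr (_ *: _); field.
Qed.

Lemma iter_slice_d_slice_dbar {R : realType} (m n k : nat) (q : quaternion R) :
  ~ real_quaternion q ->
  iter k (fun g => slice_d (slice_dbar g)) (qmonomial m n) q =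
    (m ^_ k * n ^_ k)%:R *: qmonomial (m - k) (n - k) q.
Proof.
elim: k q => [|k IHk] q qR; first by rewrite !subn0 scale1r.
rewrite iterS
  (slice_d_qmonomial _ ((m ^_ k * n ^_ k)%:R * (n - k)%:R) (m - k) (n - k).-1) //.
  by rewrite -!natrM !ffactnSr mulnACA -mulnA (mulnC (n - k)%N) !subnS.
by move=> p pR; apply: slice_dbar_qmonomial.
Qed.

Theorem proposition3p7 (R : realType) (m n : nat) (q : quaternion R)
    (hq : ~ real_quaternion q) :
  [series ((-1) ^+ k / k`!%:R) *:
      iter k (fun g => slice_d (slice_dbar g)) (fun p => p ^+ m * conjq p ^+ n) q]_k
    @ \oo --> quat_hermite m n q.
Proof.
have termE k : ((-1) ^+ k / k`!%:R) *:
    iter k (fun g => slice_d (slice_dbar g)) (qmonomial m n) q =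
    ((-1) ^+ k * (k`! * 'C(m, k) * 'C(n, k))%:R) *: qmonomial (m - k) (n - k) q.
  rewrite iter_slice_d_slice_dbar// scalerA; congr (_ *: _).
  rewrite -mulrA; congr (_ * _); rewrite -!bin_ffact !natrM.
  by field; rewrite pnatr_eq0 -lt0n fact_gt0.
(* every term after the index [minn m n] vanishes *)
apply: cvg_near_cst; exists (minn m n).+1 => // N /= mnN.
rewrite /series/= /quat_hermite (big_cat_nat (leq0n _) mnN)//= [X in _ + X]big_nat.
rewrite [X in _ + X]big1 ?addr0 => [|k /andP[mnk _]]; last first.
  rewrite termE; move: mnk; rewrite gtn_min => /orP[] /bin_small ->;
  by rewrite ?muln0 ?mul0n mulr0 scale0r.
by rewrite big_mkord; apply: eq_bigr => k _; exact: termE.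
Qed.
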